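(* Let $D,N$ be integers with $D\ge 1$, $D+1<N$ and $D\le \frac{N}{2}$. Let $\mathcal{C}$ be the binary linear code with parity-check matrix $M(D,D+1,N)$. Then the rate $R$ of $\mathcal{C}$ satisfies $R\ge 1-\frac{D+1}{N-D}$.
   Context: Write $[N]=\{1,\dots,N\}$. For integers $D<K<N$, $M(D,K,N)$ is the $\binom{N}{D}\times\binom{N}{K}$ binary matrix whose rows are indexed by the $D$-element subsets of $[N]$ and whose columns are indexed by the $K$-element subsets of $[N]$, with a $1$ in position $(S,U)$ if and only if $S\subseteq U$. The binary code with parity-check matrix $H$ (with $n$ columns) is $\{\mathbf{x}\in\mathbb{F}_2^n : H\mathbf{x}^T=\mathbf{0}\}$; if it has dimension $k$, its rate is $k/n$. *)

(* Defs.v *)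
From mathcomp Require Import all_boot all_order all_algebra.
Set Implicit Arguments.
Unset Strict Implicit.
Unset Printing Implicit Defensive.
Import GRing.Theory.
Local Open Scope ring_scope.

(* The ground set [N] = {1, ..., N} is represented by 'I_N. *)
Definition ksubsets (N K : nat) : {set {set 'I_N}} :=
  [set A : {set 'I_N} | #|A| == K].

Lemma card_ksubsets (N K : nat) : #|ksubsets N K| = 'C(N, K).
Proof. by rewrite /ksubsets card_draws card_ord. Qed.

(* Rows and columns are numbered by the enumerations of the D-subsets and of
   the K-subsets; by card_ksubsets the shape is 'C(N, D) x 'C(N, K). *)
Definition inclusion_mx (D K N : nat) :
    'M['F_2]_(#|ksubsets N D|, #|ksubsets N K|) :=
  \matrix_(i < #|ksubsets N D|, j < #|ksubsets N K|)
    (enum_val i \subset enum_val j)%:R.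

Definition parity_check_code (m n : nat) (H : 'M['F_2]_(m, n)) :
    {vspace 'rV['F_2]_n} :=
  lker (linfun (mulmx H \o trmx)).

Lemma mem_parity_check_code (m n : nat) (H : 'M['F_2]_(m, n))
    (x : 'rV['F_2]_n) :
  (x \in parity_check_code H) = (H *m x^T == 0).
Proof. by rewrite memv_ker lfunE. Qed.

Definition code_rate (n : nat) (C : {vspace 'rV['F_2]_n}) : rat :=
  (\dim C)%:R / n%:R.

(* Main.v *)
Require Import Defs.
From mathcomp Require Import all_boot all_order all_algebra.
Import Order.TTheory GRing.Theory Num.Theory.
Local Open Scope ring_scope.

(* An [m]-row parity-check matrix imposes at most [m] independent conditions, so
   the rate is at least [1 - m / n]; here [m / n = 'C(N, D) / 'C(N, D + 1)],
   which is [(D + 1) / (N - D)]. *)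

Lemma leq_dim_parity_check_code (m n : nat) (H : 'M['F_2]_(m, n)) :
  (n <= \dim (parity_check_code H) + m)%N.
Proof.
have dimM p q : \dim {:'M['F_2]_(p, q)} = (p * q)%N by rewrite dimvf.
rewrite /parity_check_code; set f := linfun _.
(* Rank-nullity for [f]: the code is its kernel, and its image lies in the space of column vectors
   of length [m], so the two dimensions add up to [n] with the second at most [m]. *)
have := limg_ker_dim f fullv; rewrite capfv dimM mul1n => {1}<-.
rewrite leq_add2l; apply: leq_trans (dimvS (subvf _)) _.
by rewrite dimM muln1.
Qed.

Lemma code_rate_ge (m n : nat) (H : 'M['F_2]_(m, n)) :
  (0 < n)%N -> 1 - m%:R / n%:R <= code_rate (parity_check_code H).
Proof.
move=> n_gt0; have n_gt0Q : 0 < n%:R :> rat by rewrite ltr0n.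
rewrite lerBlDr /code_rate -mulrDl ler_pdivlMr // mul1r -natrD ler_nat.
exact: leq_dim_parity_check_code.
Qed.

Lemma bin_ratio (F : numFieldType) (D N : nat) : (D < N)%N ->
  'C(N, D)%:R / 'C(N, D.+1)%:R = D.+1%:R / (N%:R - D%:R) :> F.
Proof.
move=> ltDN; rewrite -natrB; last exact: ltnW.
have bin_neq0 : 'C(N, D.+1)%:R != 0 :> F by rewrite pnatr_eq0 -lt0n bin_gt0.
have sub_neq0 : (N - D)%:R != 0 :> F by rewrite pnatr_eq0 -lt0n subn_gt0.
(* After cross-multiplication this is [D.+1 * 'C(N, D.+1) = (N - D) * 'C(N, D)]. *)
by apply/eqP; rewrite eqr_div // -!natrM mul_bin_left mulnC.
Qed.

Theorem proposition3p7 (D N : nat) (hD : (1 <= D)%N) (hDN : (D + 1 < N)%N)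
    (hD2 : D%:R <= N%:R / 2%:R :> rat) :
  1 - (D%:R + 1) / (N%:R - D%:R)
    <= code_rate (parity_check_code (inclusion_mx D (D + 1) N)).
Proof.
move: hDN; rewrite addn1 natr1 => ltD1N.
rewrite -bin_ratio; last exact: ltnW.
(* The binomials become the row and column counts of [inclusion_mx]. *)
rewrite -(card_ksubsets N D) -(card_ksubsets N D.+1).
by apply: code_rate_ge; rewrite card_ksubsets bin_gt0 ltnW.
Qed.
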